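(* The class of $\mathrm{DerPerm}_{\succ}$ algebras, i.e. the class of all algebras with one bilinear operation $\succ$ that embed into $(A,\succ)$ for some perm algebra $A$ with derivation $d$, where $a\succ b=d(a)b$ on $A$, is a variety (that is, it is exactly the class of all algebras with one bilinear operation satisfying some set of polynomial identities).
   Context: All algebras are over a fixed field $\mathbb K$. A perm algebra is an associative (not necessarily unital) algebra satisfying $abc=bac$; a derivation is a linear map $d$ with $d(ab)=d(a)b+a\,d(b)$. ''Embeds'' means that there is an injective algebra homomorphism. *)

(* Defs.v *)
From HB Require Import structures.
From mathcomp Require Import all_boot all_order all_algebra.
From mathcomp Require Import finmap.
From mathcomp Require Import monalg.

Set Implicit Arguments.
Unset Strict Implicit.
Unset Printing Implicit Defensive.

Import GRing.Theory.
Local Open Scope ring_scope.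

(* A K-vector space with one bilinear operation: no associativity, no unit and
   no finiteness condition on the dimension. *)
Record algebra (K : fieldType) := Algebra {
  alg_sort :> lmodType K;
  alg_mul : {bilinear alg_sort -> alg_sort -> alg_sort}
}.
Arguments alg_mul {K a}.

Definition embeds (K : fieldType) (A B : algebra K) : Prop :=
  exists f : {linear A -> B},
    injective f /\ forall x y : A, f (alg_mul x y) = alg_mul (f x) (f y).

Definition perm_algebra (K : fieldType) (A : algebra K) : Prop :=
  associative (alg_mul : A -> A -> A) /\
  forall a b c : A,
    alg_mul (alg_mul a b) c = alg_mul (alg_mul b a) c.

Definition derivation (K : fieldType) (A : algebra K) (d : {linear A -> A}) :
  Prop :=
  forall a b : A, d (alg_mul a b) = alg_mul (d a) b + alg_mul a (d b).

Definition succ_mul (K : fieldType) (A : algebra K) (d : {linear A -> A})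
  (a b : A) : A := alg_mul (d a) b.

Lemma succ_mul_bilinear (K : fieldType) (A : algebra K) (d : {linear A -> A}) :
  bilinear_for *:%R *:%R (succ_mul d).
Proof.
split=> [b|a] k x y; first by rewrite /succ_mul linearP linearPl.
by rewrite /succ_mul linearPr.
Qed.

HB.instance Definition _ (K : fieldType) (A : algebra K)
    (d : {linear A -> A}) :=
  bilinear_isBilinear.Build K A A A *:%R *:%R (succ_mul d)
    (succ_mul_bilinear d).

Definition succ_algebra (K : fieldType) (A : algebra K) (d : {linear A -> A}) :
  algebra K := @Algebra K A (succ_mul d).

Definition DerPerm_succ (K : fieldType) (V : algebra K) : Prop :=
  exists (A : algebra K) (d : {linear A -> A}),
    [/\ perm_algebra A, derivation d & embeds V (succ_algebra d)].

(* The free magma on the variables x_0, x_1, x_2, ... *)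
Inductive magma := MVar of nat | MMul of magma & magma.

Fixpoint magma_encode (m : magma) : GenTree.tree nat :=
  match m with
  | MVar i => GenTree.Leaf i
  | MMul m1 m2 => GenTree.Node 0 [:: magma_encode m1; magma_encode m2]
  end.

Fixpoint magma_decode (t : GenTree.tree nat) : option magma :=
  match t with
  | GenTree.Leaf i => Some (MVar i)
  | GenTree.Node _ [:: t1; t2] =>
      if (magma_decode t1, magma_decode t2) is (Some m1, Some m2)
      then Some (MMul m1 m2) else None
  | _ => None
  end.

Lemma magma_encodeK : pcancel magma_encode magma_decode.
Proof. by elim=> //= m1 -> m2 ->. Qed.

HB.instance Definition _ := Countable.copy magma (pcan_type magma_encodeK).

Fixpoint magma_eval (K : fieldType) (V : algebra K) (v : nat -> V)
  (m : magma) : V :=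
  match m with
  | MVar i => v i
  | MMul m1 m2 => alg_mul (magma_eval v m1) (magma_eval v m2)
  end.

(* {malg K[magma]} is the underlying vector space of the free nonassociative
   K-algebra on countably many variables; [npoly_eval v] is the homomorphism
   from it to V that sends x_i to v i. *)
Definition npoly_eval (K : fieldType) (V : algebra K) (v : nat -> V)
  (p : {malg K[magma]}) : V :=
  \sum_(m <- msupp p) p@_m *: magma_eval v m.

Definition satisfies (K : fieldType) (V : algebra K) (p : {malg K[magma]}) :
  Prop := forall v : nat -> V, npoly_eval v p = 0.

Definition is_variety (K : fieldType) (C : algebra K -> Prop) : Prop :=
  exists S : {malg K[magma]} -> Prop,
    forall V : algebra K, C V <-> (forall p, S p -> satisfies V p).

(* Main.v *)
Require Import Defs.
From HB Require Import structures.
From mathcomp Require Import all_boot all_order all_algebra.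
From mathcomp Require Import finmap monalg.
From mathcomp Require Import boolp functions.
From mathcomp Require Import zify.

(** The variety is the one defined by all identities that hold in every
    [succ_algebra d].  One inclusion holds because identities pass to
    subalgebras; the content is that an algebra [V] satisfying these identities
    embeds into a perm algebra with derivation.

    Call a word [x1^(n1) ... xk^(nk)] in formal derivatives balanced when
    [n1 + ... + nk = k].  In a perm algebra with derivation, left multiplication
    by the value of a balanced word is an operation of [succ_algebra d]: it can
    be written with [a *> b = d(a) b] alone.  Indeed
      [u' y = u *> y], and
      [u^(n+1) x1 ... xn y = (u^(n) x2 ... xn x1) *> y
         - sum_i xi *> (u^(n) x1 ... (no xi) ... xn y)],
    and a balanced word is, up to reordering, a product of such blocks
    [u^(n) x_1 ... x_(n-1)]: each letter of order [n > 0] has its [n - 1]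
    letters of order 0.  This gives, in every algebra [V], an explicit operation
    [word_action w y] (zero when [w] is not balanced).  The identities it obeys
    in the algebras [succ_algebra d] (symmetry in the letters, linearity, the
    Leibniz rule for a letter [a *> b], and [w (a *> b) = (w a') b]) therefore
    hold in [V] ([identities_word_laws]).

    The enveloping algebra is then built on functions instead of on a quotient.
    Let [N] be the space of functions from words over [V] to [V] that respect
    swaps of letters, linearity and the Leibniz rule.  Letters act on [N] by
    shifting the argument, formal differentiation acts by [shift], which is minus
    its transpose, and the commutator of [shift] with the letter [x^(n)] is the
    letter [x^(n+1)].  So the algebra [B] of operators generated by the letters is
    commutative with derivation [[shift, -]], and [B * N] with the product
    [(b, g)(b', g') = (b b', b g')] is a perm algebra with derivation
    [([shift, -], shift)].  The map sending [y] to the letter [y] and to the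
    function [w |-> word_action w y] is the embedding; it is injective since the
    function takes the value [y] at the empty word. *)

Set Implicit Arguments.
Unset Strict Implicit.
Unset Printing Implicit Defensive.

Import GRing.Theory.
Local Open Scope ring_scope.

Local Notation "a *> b" := (alg_mul a b) (at level 40, left associativity).

(** * Words in formal derivatives *)

Section DifferentialWords.
Variable T : Type.
Implicit Types (w u : seq (T * nat)) (n : nat).

(** The pair [(x, n)] is the formal derivative [x^(n)]; the terms of the
    derivative of a product are listed with repetition, so that sums over them
    need no binomial coefficients. *)
Fixpoint word_deriv w : seq (seq (T * nat)) :=
  if w is l :: w' then
    ((l.1, l.2.+1) :: w') :: [seq l :: u | u <- word_deriv w']
  else [::].

Definition word_derivn n w : seq (seq (T * nat)) :=
  iter n (fun ws => flatten [seq word_deriv u | u <- ws]) [:: w].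

Definition total_order w : nat := sumn [seq l.2 | l <- w].

(** Every formal derivative [x^(n)] has weight [n - 1], so that [a *> b] has the
    weight of [a] plus the weight of [b] plus one.  The balanced words are those
    of weight 0. *)
Definition balanced w : bool := total_order w == size w.

Lemma word_deriv_cat w1 w2 :
  word_deriv (w1 ++ w2) =
  [seq u ++ w2 | u <- word_deriv w1] ++ [seq w1 ++ u | u <- word_deriv w2].
Proof.
elim: w1 => [|l w1 IH] /=; first by rewrite map_id.
by rewrite IH map_cat -!map_comp.
Qed.

Lemma word_deriv_all w :
  all (fun u => (total_order u == (total_order w).+1) && (size u == size w))
    (word_deriv w).
Proof.
elim: w => //= l w IH; rewrite /total_order /= addSn !eqxx /= all_map.
apply: sub_all IH => u /=; rewrite /total_order /= => /andP[/eqP -> /eqP ->].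
by rewrite addnS !eqxx.
Qed.

Lemma word_derivn_all n w :
  all (fun u => (total_order u == total_order w + n)%N && (size u == size w))
    (word_derivn n w).
Proof.
elim: n => [|n IH] /=; first by rewrite addn0 !eqxx.
rewrite -/(word_derivn n w).
elim: (word_derivn n w) IH => //= u ws IHws.
move=> /andP[/andP[/eqP Eu /eqP Su] /IHws IH].
rewrite all_cat IH andbT.
by apply: sub_all (word_deriv_all u) => t; rewrite Eu Su addnS.
Qed.

Lemma total_order_cat w1 w2 :
  total_order (w1 ++ w2) = (total_order w1 + total_order w2)%N.
Proof. by rewrite /total_order map_cat sumn_cat. Qed.

End DifferentialWords.

Definition map_word (T U : Type) (h : T -> U) (w : seq (T * nat)) :=
  [seq (h l.1, l.2) | l <- w].

Section MapWord.
Variables (T U : Type) (h : T -> U).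

Lemma map_word_cat w1 w2 :
  map_word h (w1 ++ w2) = map_word h w1 ++ map_word h w2.
Proof. exact: map_cat. Qed.

Lemma total_order_map w : total_order (map_word h w) = total_order w.
Proof. by rewrite /total_order -map_comp. Qed.

Lemma balanced_map w : balanced (map_word h w) = balanced w.
Proof. by rewrite /balanced total_order_map size_map. Qed.

Lemma word_deriv_map w :
  word_deriv (map_word h w) = [seq map_word h u | u <- word_deriv w].
Proof.
elim: w => //= l w IH; congr (_ :: _).
by rewrite IH -!map_comp.
Qed.

Lemma word_derivn_map n w :
  word_derivn n (map_word h w) = [seq map_word h u | u <- word_derivn n w].
Proof.
elim: n => //= n ->; rewrite map_flatten -!map_comp; congr flatten.
by apply: eq_map => u /=; rewrite word_deriv_map.
Qed.

End MapWord.

(** * Balanced words act on every algebra *)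

Section Picks.
Variable T : Type.

Fixpoint picks (xs : seq T) : seq (T * seq T) :=
  if xs is x :: xs' then
    (x, xs') :: [seq (p.1, x :: p.2) | p <- picks xs']
  else [::].

Lemma size_picks xs : all (fun p => size p.2 == (size xs).-1) (picks xs).
Proof.
elim: xs => //= x xs IH; rewrite eqxx /= all_map.
by case: xs IH => //= y s; apply: sub_all => p /= /eqP ->.
Qed.

End Picks.

Lemma picks_map (T U : Type) (h : T -> U) xs :
  picks (map h xs) = [seq (h p.1, map h p.2) | p <- picks xs].
Proof. by elim: xs => //= x xs ->; rewrite -!map_comp. Qed.

Section Operators.
Variables (K : fieldType) (V : algebra K).

(** The operation that equals [u^(n+1) xs y] in perm algebras with derivation
    when [n] is the size of [xs].  The recursion expands [d (u^(n) xs' x) y] and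
    solves for the term in which [u] is differentiated. *)
Fixpoint block (n : nat) (u : V) (xs : seq V) (y : V) : V :=
  match n, xs with
  | n'.+1, x :: xs' =>
      (block n' u xs' x *> y) - \sum_(p <- picks xs) (p.1 *> block n' u p.2 y)
  | _, _ => u *> y
  end.

(** A letter of order [n] is grouped with the next [n - 1] letters of order
    0. *)
Fixpoint blocks (ps : seq (V * nat)) (zs : seq V) (y : V) : V :=
  if ps is l :: ps' then
    block l.2.-1 l.1 (take l.2.-1 zs) (blocks ps' (drop l.2.-1 zs) y)
  else y.

Definition derived (w : seq (V * nat)) := [seq l <- w | l.2 != 0%N].
Definition underived (w : seq (V * nat)) := [seq l.1 | l <- w & l.2 == 0%N].

(** Only balanced words give operations of [succ_algebra d]; on the others the
    value 0 is consistent with all the laws below, each of which relates words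
    of equal weight. *)
Definition word_action (w : seq (V * nat)) (y : V) : V :=
  if balanced w then blocks (derived w) (underived w) y else 0.

End Operators.

Section Naturality.
Variables (K : fieldType) (U V : algebra K) (h : {linear U -> V}).
Hypothesis hM : forall x y : U, h (x *> y) = h x *> h y.

Lemma block_morph n u xs y :
  h (block n u xs y) = block n (h u) (map h xs) (h y).
Proof.
elim: n u xs y => [|n IH] u [|x xs] y; rewrite ?hM //.
rewrite [LHS]linearB linear_sum /= hM IH !big_cons hM IH.
congr (_ - (_ + _)); rewrite picks_map -map_comp !big_map.
by apply: eq_bigr => p _; rewrite hM IH.
Qed.

Lemma blocks_morph ps zs y :
  h (blocks ps zs y) = blocks (map_word h ps) (map h zs) (h y).
Proof.
by elim: ps zs y => //= l ps IH zs y; rewrite block_morph IH map_take map_drop.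
Qed.

(** Each [word_action] is a polynomial in the operation, hence natural.  For the
    free algebra this says that a law for [word_action] is a set of polynomial
    identities. *)
Lemma word_action_morph w y :
  h (word_action w y) = word_action (map_word h w) (h y).
Proof.
rewrite /word_action balanced_map; case: ifP => // _; last exact: linear0.
by rewrite blocks_morph /derived /underived !filter_map -!map_comp.
Qed.

End Naturality.

(** * Evaluation in a perm algebra with derivation *)

Section PermEvaluation.
Variables (K : fieldType) (A : algebra K) (d : {linear A -> A}).
Hypotheses (permA : perm_algebra A) (derd : derivation d).

Let mA : associative (alg_mul : A -> A -> A) := permA.1.

Lemma perm_left_comm (a b c : A) : a *> (b *> c) = b *> (a *> c).
Proof. by rewrite !mA permA.2. Qed.

Definition word_eval (w : seq (A * nat)) (y : A) : A :=
  foldr (fun l z => iter l.2 d l.1 *> z) y w.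

Lemma word_eval_cat w1 w2 y :
  word_eval (w1 ++ w2) y = word_eval w1 (word_eval w2 y).
Proof. exact: foldr_cat. Qed.

Lemma word_eval_left_comm a w y :
  word_eval w (a *> y) = a *> word_eval w y.
Proof. by elim: w => //= l w ->; rewrite perm_left_comm. Qed.

Lemma word_eval_comm w1 w2 y :
  word_eval w1 (word_eval w2 y) = word_eval w2 (word_eval w1 y).
Proof. by elim: w1 => //= l w1 ->; rewrite word_eval_left_comm. Qed.

Lemma word_eval_mul w x y : word_eval w x *> y = word_eval w (x *> y).
Proof. by elim: w => //= l w <-; rewrite mA. Qed.

Lemma deriv_word_eval w y :
  d (word_eval w y) = \sum_(u <- word_deriv w) word_eval u y + word_eval w (d y).
Proof.
elim: w => /= [|l w IH]; first by rewrite big_nil add0r.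
rewrite derd IH big_cons big_map linearD linear_sum /= addrA.
by [].
Qed.

(** The tail [y] is differentiated along with the word on the first term of the
    right-hand side, and this contribution is subtracted. *)
Lemma derivn_word_eval n w y :
  \sum_(u <- word_derivn n.+1 w) word_eval u y =
  d (\sum_(u <- word_derivn n w) word_eval u y)
    - \sum_(u <- word_derivn n w) word_eval u (d y).
Proof.
rewrite /= big_flatten big_map linear_sum -sumrB.
by apply: eq_bigr => u _; rewrite deriv_word_eval addrK.
Qed.

Local Notation plain xs := [seq (x, 0%N) | x <- xs].

Lemma word_deriv_plain xs y :
  \sum_(u <- word_deriv (plain xs)) word_eval u y =
  \sum_(p <- picks xs) d p.1 *> word_eval (plain p.2) y.
Proof.
elim: xs => [|x xs IH] /=; first by rewrite !big_nil.
rewrite !big_cons !big_map /= -linear_sum IH linear_sum.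
by congr (_ + _); apply: eq_bigr => p _; rewrite perm_left_comm.
Qed.

Local Notation V := (succ_algebra d).

(** With [f = u^(n+1) xs x], the first term [d(f) y] of the recursion is
    [d(f y) - f d(y)], where the [f z] are products over the plain word
    [x :: xs]; the Leibniz rule leaves the derivative of [u] and the sum that
    the recursion subtracts. *)
Lemma block_eval n (u : A) xs y : size xs = n ->
  block (V := V) n u xs y = iter n.+1 d u *> word_eval (plain xs) y.
Proof.
elim: n u xs y => [|n IH] u [|x xs] y //= [sx].
rewrite /succ_mul IH //.
set D := iter n.+1 d u.
have -> : \sum_(p <- picks (x :: xs))
    succ_mul d p.1 (block (V := V) n u p.2 y) =
    D *> \sum_(t <- word_deriv (plain (x :: xs))) word_eval t y.
  rewrite word_deriv_plain linear_sum; apply: eq_big_seq => p pin.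
  have /allP/(_ _ pin)/eqP sp := size_picks (x :: xs).
  by rewrite /succ_mul IH ?sp // perm_left_comm.
have dl (f g : A) : d f *> g = d (f *> g) - f *> d g by rewrite derd addrK.
have absorb z : word_eval (plain xs) x *> z = word_eval (plain (x :: xs)) z.
  by rewrite word_eval_mul /= word_eval_left_comm.
rewrite dl -!mA !absorb derd deriv_word_eval linearD /= addrA addrK.
by rewrite addrK.
Qed.

Lemma blocks_eval (ps : seq (A * nat)) (zs : seq A) (y : A) :
    all (fun l => l.2 != 0%N) ps -> total_order ps = (size ps + size zs)%N ->
  blocks (V := V) ps zs y = word_eval ps (word_eval (plain zs) y).
Proof.
elim: ps zs => [|[x n] ps IH] zs /=; first by case: zs.
case: n => //= n allps; rewrite /total_order /= -/(total_order ps) => Eps.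
(* All orders are positive, so the letters of order 0 suffice for the first
   block. *)
have ps_large : (size ps <= total_order ps)%N.
  elim: ps {IH Eps} allps => //= l ps IHps /andP[l0 /IHps].
  by rewrite /total_order /=; lia.
have {}Eps : (n + total_order ps = size ps + size zs)%N by case: Eps.
have n_small : (n <= size zs)%N.
  by rewrite -(leq_add2l (size ps)) -Eps addnC leq_add2l.
rewrite block_eval ?size_takel // IH //; last first.
  by rewrite size_drop addnBA // -Eps addnC addnK.
rewrite word_eval_comm -[in RHS](cat_take_drop n zs) map_cat word_eval_cat.
by [].
Qed.

Lemma word_eval_split w y :
  word_eval w y =
  word_eval (derived w) (word_eval (plain (underived w)) y).
Proof.
elim: w => //= -[x [|n]] w IH /=; rewrite /underived /= IH //.
by rewrite word_eval_left_comm.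
Qed.

(** Balancedness provides exactly as many letters of order 0 as the blocks of
    the letters of positive order require. *)
Lemma word_action_eval (w : seq (A * nat)) (y : A) :
  word_action (V := V) w y = if balanced w then word_eval w y else 0.
Proof.
rewrite /word_action; case: ifP => // /eqP bw; rewrite word_eval_split.
apply: blocks_eval; first exact: filter_all.
have -> : total_order (derived w) = total_order w.
  rewrite /total_order; elim: w {bw} => //= -[x [|n]] w IH //=.
  by congr (_ + _)%N.
rewrite bw /derived /underived size_map !size_filter.
rewrite -(count_predC (fun l : A * nat => l.2 != 0%N) w); congr (_ + _)%N.
by apply: eq_count => l /=; rewrite negbK.
Qed.
End PermEvaluation.

(** * The free algebra on countably many variables *)

Section FreeAlgebra.
Variable K : fieldType.
Implicit Types (p q : {malg K[magma]}).

Definition magma_extend (W : lmodType K) (f : magma -> W) p : W :=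
  \sum_(m <- msupp p) p@_m *: f m.

Section Extend.
Variables (W : lmodType K) (f : magma -> W).

Lemma magma_extend_widen (D : {fset magma}) p : (msupp p `<=` D)%fset ->
  magma_extend f p = \sum_(m <- D) p@_m *: f m.
Proof.
move=> le_pD; apply: big_fset_incl le_pD _ => m _ /mcoeff_outdom ->.
by rewrite scale0r.
Qed.

Lemma magma_extend_is_linear : linear (magma_extend f).
Proof.
move=> c p q; pose D := (msupp p `|` msupp q `|` msupp (c *: p + q))%fset.
have sD (r : {malg K[magma]}) : r \in [:: p; q; c *: p + q] ->
    magma_extend f r = \sum_(m <- D) r@_m *: f m.
  move=> rin; apply: magma_extend_widen; apply/fsubsetP => m mr.
  by move: rin; rewrite !inE => /or3P[] /eqP <-; rewrite mr ?orbT.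
rewrite !sD ?inE ?eqxx ?orbT //.
rewrite scaler_sumr -big_split; apply: eq_bigr => m _ /=.
by rewrite mcoeffD mcoeffZ scalerDl scalerA.
Qed.

HB.instance Definition _ := GRing.isLinear.Build K {malg K[magma]} W *:%R
  (magma_extend f) magma_extend_is_linear.

Lemma magma_extendU m : magma_extend f << m >> = f m.
Proof.
by rewrite /magma_extend msuppU oner_eq0 big_seq_fset1 mcoeffUU scale1r.
Qed.

End Extend.

Definition npoly_mul p q : {malg K[magma]} :=
  magma_extend (fun m => magma_extend (fun n => << MMul m n >>) q) p.

Lemma npoly_mul_bilinear : bilinear_for *:%R *:%R npoly_mul.
Proof.
split=> [q|p] c a b; first by rewrite /npoly_mul linearP.
pose F q m := magma_extend (fun n => << MMul m n >> : {malg K[magma]}) q.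
rewrite -[LHS]/(magma_extend (F (c *: a + b)) p).
rewrite -[RHS]/(c *: magma_extend (F a) p + magma_extend (F b) p).
rewrite /magma_extend scaler_sumr -big_split; apply: eq_bigr => m _ /=.
by rewrite {1}/F linearP /= scalerDr !scalerA mulrC.
Qed.

HB.instance Definition _ := bilinear_isBilinear.Build K {malg K[magma]}
  {malg K[magma]} {malg K[magma]} *:%R *:%R npoly_mul npoly_mul_bilinear.

Definition free_algebra : algebra K := @Algebra K {malg K[magma]} npoly_mul.

Section Evaluation.
Variables (V : algebra K) (v : nat -> V).

HB.instance Definition _ := GRing.isLinear.Build K {malg K[magma]} V *:%R
  (npoly_eval v) (magma_extend_is_linear (magma_eval v)).

Lemma npoly_eval_linear c p q :
  npoly_eval v (c *: p + q) = c *: npoly_eval v p + npoly_eval v q.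
Proof. exact: magma_extend_is_linear. Qed.

Lemma npoly_evalU m : npoly_eval v << m >> = magma_eval v m.
Proof. exact: magma_extendU. Qed.

Lemma npoly_eval_mul (p q : free_algebra) :
  npoly_eval v (p *> q) = npoly_eval v p *> npoly_eval v q.
Proof.
rewrite /= /npoly_mul [in LHS]/magma_extend linear_sum /=.
rewrite [npoly_eval v p]/npoly_eval linear_sumlz /=; apply: eq_bigr => m _.
rewrite linearZ /= linearZl_LR; congr (_ *: _).
rewrite linear_sum /= [npoly_eval v q]/npoly_eval.
rewrite linear_sumr; apply: eq_bigr => n _.
by rewrite linearZ linearZr_LR /= npoly_evalU.
Qed.

End Evaluation.
End FreeAlgebra.

(** * Laws of word actions *)

Section Laws.
Variables (K : fieldType) (V : algebra K).

(** What is needed of [word_action] for the embedding.  The letters of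
    [word_derivn n [:: (a, 1); (b, 0)]] come from differentiating the formal
    product [a' b] which [a *> b] stands for. *)
Record word_laws : Prop := WordLaws {
  word_action_swap : forall w1 w2 l l' (y : V),
    word_action (w1 ++ l :: l' :: w2) y = word_action (w1 ++ l' :: l :: w2) y;
  word_action_linear : forall c a b n w (y : V),
    word_action ((c *: a + b, n) :: w) y =
    c *: word_action ((a, n) :: w) y + word_action ((b, n) :: w) y;
  word_action_leibniz : forall a b n w (y : V),
    word_action ((a *> b, n) :: w) y =
    \sum_(u <- word_derivn n [:: (a, 1%N); (b, 0%N)]) word_action (u ++ w) y;
  word_action_tail_linear : forall w c (a b : V),
    word_action w (c *: a + b) = c *: word_action w a + word_action w b;
  word_action_tail : forall w (a b : V),
    word_action w (a *> b) = word_action (w ++ [:: (a, 1%N)]) b }.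

End Laws.

Section LawsOfDerivations.
Variables (K : fieldType) (A : algebra K) (d : {linear A -> A}).
Hypotheses (permA : perm_algebra A) (derd : derivation d).

Lemma iter_linear n c a b :
  iter n d (c *: a + b) = c *: iter n d a + iter n d b.
Proof. by elim: n => //= n ->; rewrite linearP. Qed.

Lemma word_eval_linear w c a b :
  word_eval d w (c *: a + b) = c *: word_eval d w a + word_eval d w b.
Proof. by elim: w => //= l w ->; rewrite linearPr. Qed.

Lemma derivn_succ_eval n a b z :
  \sum_(u <- word_derivn n [:: (a, 1%N); (b, 0%N)]) word_eval d u z =
  iter n d (d a *> b) *> z.
Proof.
elim: n z => [|n IH] z; first by rewrite big_seq1 /= permA.1.
by rewrite derivn_word_eval // !IH derd addrK.
Qed.

Lemma succ_word_laws : word_laws (succ_algebra d).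
Proof.
have waE := word_action_eval permA derd.
have catE := word_eval_cat d.
split=> [w1 w2 l l' y|c a b n w y|a b n w y|w c a b|w a b].
- rewrite !waE.
  have -> : balanced (w1 ++ l :: l' :: w2) = balanced (w1 ++ l' :: l :: w2).
    rewrite /balanced !total_order_cat !size_cat /=; congr (_ + _ == _)%N.
    exact: addnCA.
  by rewrite !catE /= perm_left_comm.
- rewrite !waE -[balanced ((a, n) :: w)]/(balanced ((c *: a + b, n) :: w)).
  rewrite -[balanced ((b, n) :: w)]/(balanced ((c *: a + b, n) :: w)).
  case: ifP => _; last by rewrite scaler0 addr0.
  by rewrite /= iter_linear linearPl.
- rewrite waE.
  transitivity (\sum_(u <- word_derivn n [:: (a : A, 1%N); (b : A, 0%N)])
      if balanced ((succ_mul d a b, n) :: w) then word_eval d (u ++ w) y else 0);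
    last first.
    apply: eq_big_seq => u uin; rewrite waE.
    have /allP/(_ _ uin)/andP[/eqP ou /eqP su] :=
      word_derivn_all n [:: (a : A, 1%N); (b : A, 0%N)].
    rewrite /balanced total_order_cat size_cat ou su /=.
    by rewrite /total_order /= addn0 add1n addSn eqSS.
  case: ifP => _; last by rewrite big1.
  under eq_bigr do rewrite catE.
  by rewrite derivn_succ_eval.
- by rewrite !waE; case: ifP => _; rewrite ?word_eval_linear // scaler0 addr0.
- rewrite !waE catE /=.
  suff -> : balanced (w ++ [:: (a, 1%N)]) = balanced w by [].
  by rewrite /balanced total_order_cat size_cat eqn_add2r.
Qed.

End LawsOfDerivations.

Section Transfer.
Variable K : fieldType.

Definition succ_identity (p : {malg K[magma]}) : Prop :=
  forall (A : algebra K) (d : {linear A -> A}),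
    perm_algebra A -> derivation d -> satisfies (succ_algebra d) p.

Variable V : algebra K.
Hypothesis satV : forall p, succ_identity p -> satisfies V p.

(** It suffices to compare two polynomials in all the algebras
    [succ_algebra d], since their difference is then one of the identities
    assumed for [V]. *)
Lemma identity_transfer (p q : free_algebra K) (v : nat -> V) :
  (forall (A : algebra K) (d : {linear A -> A}) (x : nat -> succ_algebra d),
     perm_algebra A -> derivation d -> npoly_eval x p = npoly_eval x q) ->
  npoly_eval v p = npoly_eval v q.
Proof.
move=> eq_pq; apply/eqP; rewrite -subr_eq0 -linearB; apply/eqP/satV.
by move=> A d permA derd x; rewrite linearB /= (eq_pq A d x) // subrr.
Qed.

(** A law for finitely many vectors of [V] is an evaluation of the same law for
    variables of the free algebra. *)
Lemma lift_word (w : seq (V * nat)) :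
  exists (v : nat -> V) (f : V -> free_algebra K),
    map_word (npoly_eval v) (map_word f w) = w.
Proof.
pose s := [seq l.1 | l <- w].
exists (nth 0 s), (fun x => << MVar (index x s) >>).
rewrite /map_word -map_comp; apply: map_id_in => -[x n] xnw /=.
by rewrite npoly_evalU /= nth_index //; apply/mapP; exists (x, n).
Qed.

Lemma identities_word_laws : word_laws V.
Proof.
have evM (U : algebra K) (x : nat -> U) (w : seq (free_algebra K * nat)) p :
    npoly_eval x (word_action w p) =
    word_action (map_word (npoly_eval x) w) (npoly_eval x p).
  exact: (word_action_morph (npoly_eval_mul x)).
split=> [w1 w2 l l' y|c a b n w y|a b n w y|w c a b|w a b].
- have [v [f]] := lift_word (l :: l' :: (y, 0%N) :: w1 ++ w2).
  case: l l' => [a m] [b n]; rewrite /= !map_word_cat => -[fa fb fy].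
  move/eqP; rewrite eqseq_cat ?size_map // => /andP[/eqP fw1 /eqP fw2].
  have := @identity_transfer
    (word_action (map_word f w1 ++ (f a, m) :: (f b, n) :: map_word f w2) (f y))
    (word_action (map_word f w1 ++ (f b, n) :: (f a, m) :: map_word f w2) (f y))
    v.
  rewrite !evM !map_word_cat /= fa fb fy fw1 fw2; apply=> A d x permA derd.
  by rewrite !evM !map_word_cat (word_action_swap (succ_word_laws permA derd)).
- have [v [f [fa fb fy fw]]] := lift_word [:: (a, 0%N), (b, 0%N), (y, 0%N) & w].
  have := @identity_transfer
    (word_action ((c *: f a + f b, n) :: map_word f w) (f y))
    (c *: word_action ((f a, n) :: map_word f w) (f y) +
     word_action ((f b, n) :: map_word f w) (f y)) v.
  rewrite !npoly_eval_linear !evM /= !npoly_eval_linear fa fb fy fw.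
  apply=> A d x permA derd.
  rewrite !npoly_eval_linear !evM /= !npoly_eval_linear.
  exact: (word_action_linear (succ_word_laws permA derd)).
- have [v [f [fa fb fy fw]]] := lift_word [:: (a, 0%N), (b, 0%N), (y, 0%N) & w].
  have sumM (U : algebra K) (x : nat -> U) :
      npoly_eval x (\sum_(u <- word_derivn n [:: (f a, 1%N); (f b, 0%N)])
        word_action (u ++ map_word f w) (f y)) =
      \sum_(u <- word_derivn n
          [:: (npoly_eval x (f a), 1%N); (npoly_eval x (f b), 0%N)])
        word_action (u ++ map_word (npoly_eval x) (map_word f w))
          (npoly_eval x (f y)).
    rewrite linear_sum /=.
    rewrite (word_derivn_map (npoly_eval x) n [:: (f a, 1%N); (f b, 0%N)]).
    rewrite big_map.
    by apply: eq_bigr => u _; rewrite evM map_word_cat.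
  have := @identity_transfer
    (word_action ((f a *> f b, n) :: map_word f w) (f y))
    (\sum_(u <- word_derivn n [:: (f a, 1%N); (f b, 0%N)])
        word_action (u ++ map_word f w) (f y)) v.
  rewrite !sumM !evM /= npoly_eval_mul fa fb fy fw; apply=> A d x permA derd.
  rewrite !sumM !evM /= npoly_eval_mul.
  exact: (word_action_leibniz (succ_word_laws permA derd)).
- have [v [f [fa fb fw]]] := lift_word [:: (a, 0%N), (b, 0%N) & w].
  have := @identity_transfer (word_action (map_word f w) (c *: f a + f b))
    (c *: word_action (map_word f w) (f a) + word_action (map_word f w) (f b)) v.
  rewrite !npoly_eval_linear !evM /= !npoly_eval_linear fa fb fw.
  apply=> A d x permA derd.
  rewrite !npoly_eval_linear !evM /= !npoly_eval_linear.
  exact: (word_action_tail_linear (succ_word_laws permA derd)).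
- have [v [f [fa fb fw]]] := lift_word [:: (a, 0%N), (b, 0%N) & w].
  have := @identity_transfer (word_action (map_word f w) (f a *> f b))
    (word_action (map_word f w ++ [:: (f a, 1%N)]) (f b)) v.
  rewrite !evM map_word_cat /= npoly_eval_mul fa fb fw.
  apply=> A d x permA derd; rewrite !evM map_word_cat /= npoly_eval_mul.
  exact: (word_action_tail (succ_word_laws permA derd)).
Qed.

End Transfer.

(** * The enveloping perm algebra *)

Section Subspaces.
Variables (K : fieldType) (W : lmodType K).

Record subspace := Subspace {
  in_subspace :> W -> Prop;
  subspace_closed :
    in_subspace 0 /\ forall c x y, in_subspace x -> in_subspace y ->
      in_subspace (c *: x + y) }.

Variable S : subspace.

Definition subspace_pred : {pred W} := fun x => `[< S x >].

Lemma subspace_pred_closed : submod_closed subspace_pred.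
Proof.
have [S0 SD] := subspace_closed S.
by split=> [|c x y /asboolP Sx /asboolP Sy]; apply/asboolP => //; apply: SD.
Qed.

HB.instance Definition _ :=
  GRing.isSubmodClosed.Build K W subspace_pred subspace_pred_closed.

Record subspace_type := SubspaceElement {
  subspace_val :> W;
  _ : subspace_val \in subspace_pred }.

HB.instance Definition _ := [isSub for subspace_val].
HB.instance Definition _ := [Choice of subspace_type by <:].
HB.instance Definition _ := [SubChoice_isSubLmodule of subspace_type by <:].

Definition subspace_elt x (Sx : S x) : subspace_type :=
  SubspaceElement (asboolT Sx : x \in subspace_pred).

Lemma subspace_valP (x : subspace_type) : S x.
Proof. by case: x => x /= /asboolP. Qed.

Lemma subspace_valB (x y : subspace_type) :
  subspace_val (x - y) = subspace_val x - subspace_val y.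
Proof. by []. Qed.

Lemma subspace_val_linear c (x y : subspace_type) :
  subspace_val (c *: x + y) = c *: subspace_val x + subspace_val y.
Proof. by []. Qed.

End Subspaces.

Section Envelope.
Variables (K : fieldType) (V : algebra K).
Local Notation word := (seq (V * nat)).

(** These functions are the restrictions to words of the linear maps to [V] from
    the unital commutative differential algebra generated by the vectors of [V]
    subject to linearity and [a *> b = a' b]; the three conditions replace the
    quotient defining that algebra.  Two of them are stated at the head of the
    word, which is enough because letters may be swapped. *)
Record compatible (g : word -> V) : Prop := Compatible {
  compatible_swap : forall w1 w2 l l',
    g (w1 ++ l :: l' :: w2) = g (w1 ++ l' :: l :: w2);
  compatible_linear : forall c a b n w,
    g ((c *: a + b, n) :: w) = c *: g ((a, n) :: w) + g ((b, n) :: w);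
  compatible_leibniz : forall a b n w,
    g ((a *> b, n) :: w) =
    \sum_(u <- word_derivn n [:: (a, 1%N); (b, 0%N)]) g (u ++ w) }.

Lemma compatible_closed :
  compatible 0 /\ forall c g h, compatible g -> compatible h ->
    compatible (c *: g + h).
Proof.
split=> [|k g h [gS gL gD] [hS hL hD]].
  by split=> [//|c a b n w|a b n w]; rewrite ?scaler0 ?addr0 // big1.
split=> [w1 w2 l l'|c a b n w|a b n w].
- by rewrite -![_ (_ ++ _)]/(k *: g _ + h _) gS hS.
- rewrite -![(_ + _) (_ :: _)]/(k *: g _ + h _) gL hL !scalerDr !scalerA mulrC.
  by rewrite addrACA.
- rewrite -![(_ + _) (_ :: _)]/(k *: g _ + h _) gD hD scaler_sumr.
  by rewrite -big_split.
Qed.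

Definition compatible_functions := Subspace compatible_closed.
Local Notation N := (subspace_type compatible_functions).

Lemma compatible_rotate (g : word -> V) l w : compatible g ->
  g (w ++ [:: l]) = g (l :: w).
Proof.
move=> cg; suff gen w1 : g (w1 ++ w ++ [:: l]) = g (w1 ++ l :: w).
  exact: (gen [::]).
elim: w w1 => [//|l' w IH] w1 /=.
by rewrite [RHS](compatible_swap cg) -cat_rcons IH cat_rcons.
Qed.

(** Letters are appended at the end, so that the conditions at the head of a
    word are preserved without moving letters. *)
Definition letter_fun (l : V * nat) (g : word -> V) : word -> V :=
  fun w => g (w ++ [:: l]).

Lemma letter_compatible l g : compatible g -> compatible (letter_fun l g).
Proof.
move=> [gS gL gD]; split=> [w1 w2 l1 l2|c a b n w|a b n w]; rewrite /letter_fun.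
- by rewrite -!catA /= gS.
- exact: gL.
- by rewrite gD; apply: eq_bigr => u _; rewrite catA.
Qed.

(** The sign makes the commutator with a letter [x^(n)] equal to [x^(n+1)] and
    not to its opposite. *)
Definition shift_fun (g : word -> V) : word -> V :=
  fun w => - \sum_(u <- word_deriv w) g u.

Lemma shift_compatible g : compatible g -> compatible (shift_fun g).
Proof.
move=> [gS gL gD]; split=> [w1 w2 l l'|c a b n w|a b n w]; rewrite /shift_fun.
- congr (- _); rewrite !word_deriv_cat !big_cat /= !big_map !big_cons !big_map.
  congr (_ + _); first by apply: eq_bigr => u _; apply: gS.
  rewrite addrCA; congr (_ + (_ + _)); [exact: gS | exact: gS |].
  by apply: eq_bigr => u _; apply: gS.
- rewrite /= !big_cons !big_map scalerN -opprD; congr (- _).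
  rewrite scalerDr addrACA -gL; congr (_ + _).
  by rewrite scaler_sumr -big_split; apply: eq_bigr => u _; rewrite /= gL.
- rewrite /= sumrN; congr (- _); rewrite big_cons big_map gD /=.
  under [in RHS]eq_bigr do rewrite word_deriv_cat big_cat !big_map.
  rewrite big_split big_flatten big_map /=; congr (_ + _).
  rewrite exchange_big; apply: eq_bigr => u _; exact: gD.
Qed.

Definition letter l (g : N) : N :=
  subspace_elt (letter_compatible l (subspace_valP g) : compatible_functions _).

Definition shift (g : N) : N :=
  subspace_elt (shift_compatible (subspace_valP g) : compatible_functions _).

Lemma compatible_function_ext (g h : N) :
  (forall w : word, subspace_val g w = subspace_val h w) -> g = h.
Proof. by move=> gh; apply/val_inj/funext. Qed.

Lemma shift_linear c g h : shift (c *: g + h) = c *: shift g + shift h.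
Proof.
apply: compatible_function_ext => w.
rewrite -[LHS]/(- \sum_(u <- word_deriv w)
  (c *: subspace_val g u + subspace_val h u)).
rewrite -[RHS]/(c *: - (\sum_(u <- word_deriv w) subspace_val g u)
  - \sum_(u <- word_deriv w) subspace_val h u).
by rewrite big_split -scaler_sumr opprD scalerN.
Qed.

HB.instance Definition _ := GRing.isLinear.Build K N N *:%R shift shift_linear.

Lemma letter_linear l c g h :
  letter l (c *: g + h) = c *: letter l g + letter l h.
Proof. exact: compatible_function_ext. Qed.

Lemma letter_comm l l' g : letter l (letter l' g) = letter l' (letter l g).
Proof.
apply: compatible_function_ext => w; rewrite /= /letter_fun -!catA.
exact: compatible_swap (subspace_valP g) _ _ _ _.
Qed.

(** The terms in which the argument is differentiated cancel; what remains is
    the derivative of the appended letter. *)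
Lemma shift_letter a n g :
  shift (letter (a, n) g) - letter (a, n) (shift g) = letter (a, n.+1) g.
Proof.
apply: compatible_function_ext => w; rewrite subspace_valB.
rewrite -[LHS]/(- (\sum_(u <- word_deriv w) subspace_val g (u ++ [:: (a, n)])) -
  - \sum_(u <- word_deriv (w ++ [:: (a, n)])) subspace_val g u).
rewrite opprK word_deriv_cat big_cat !big_map /= big_seq1 addrA addNr add0r.
by [].
Qed.

Lemma letter_vector_linear c a b g :
  letter (c *: a + b, 0%N) g = c *: letter (a, 0%N) g + letter (b, 0%N) g.
Proof.
apply: compatible_function_ext => w; rewrite subspace_val_linear.
rewrite -[RHS]/(c *: subspace_val g (w ++ _) + subspace_val g (w ++ _)).
have cg := subspace_valP g.
by rewrite /= /letter_fun !compatible_rotate // compatible_linear.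
Qed.

Lemma letter_succ a b g :
  letter (a *> b, 0%N) g = letter (a, 1%N) (letter (b, 0%N) g).
Proof.
apply: compatible_function_ext => w; have cg := subspace_valP g.
rewrite /= /letter_fun compatible_rotate // compatible_leibniz // big_seq1 /=.
rewrite [RHS]compatible_rotate //.
exact: esym (compatible_rotate _ ((b, 0%N) :: w) cg).
Qed.

(** The algebra of operators generated by the letters: commutative because the
    letters commute, and stable under the commutator with [shift]. *)
Inductive operator : (N -> N) -> Prop :=
  | operator_zero : operator 0
  | operator_combination c b b' :
      operator b -> operator b' -> operator (c *: b + b')
  | operator_letter l : operator (letter l)
  | operator_comp b b' : operator b -> operator b' -> operator (b \o b').

Lemma operator_linear b : operator b ->
  forall c g h, b (c *: g + h) = c *: b g + b h.
Proof.
elim=> [|k b1 b2 _ b1L _ b2L|l|b1 b2 _ b1L _ b2L] c g h.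
- by rewrite scaler0 addr0.
- rewrite -![(_ + _) _]/(k *: b1 _ + b2 _) b1L b2L !scalerDr !scalerA mulrC.
  by rewrite addrACA.
- exact: letter_linear.
- by rewrite /= b2L b1L.
Qed.

Lemma operator_map0 b : operator b -> b 0 = 0.
Proof.
move=> /operator_linear bL; have := bL (- 1) 0 0.
by rewrite scaler0 addr0 scaleN1r addNr.
Qed.

Lemma operator_comm b b' : operator b -> operator b' ->
  forall g, b (b' g) = b' (b g).
Proof.
move=> opb; elim=> [|k b1 b2 _ b1C _ b2C|l|b1 b2 _ b1C _ b2C] g.
- by rewrite operator_map0.
- rewrite -[(k *: b1 + b2) g]/(k *: b1 g + b2 g) operator_linear //.
  by rewrite b1C b2C.
- elim: opb g => [|k b1 b2 _ b1C _ b2C|l'|b1 b2 _ b1C _ b2C] g.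
  + by rewrite (operator_map0 (operator_letter l)).
  + rewrite -[(k *: b1 + b2) g]/(k *: b1 g + b2 g) letter_linear.
    by rewrite -b1C -b2C.
  + exact: letter_comm.
  + by rewrite /= b2C b1C.
- by rewrite /= b1C b2C.
Qed.

Definition shift_bracket (b : N -> N) : N -> N :=
  fun g => shift (b g) - b (shift g).

Lemma shift_bracket_linear c b b' :
  shift_bracket (c *: b + b') = c *: shift_bracket b + shift_bracket b'.
Proof.
apply/funext => g.
rewrite -[RHS]/(c *: (shift (b g) - b (shift g)) +
  (shift (b' g) - b' (shift g))).
rewrite -[LHS]/(shift (c *: b g + b' g) - (c *: b (shift g) + b' (shift g))).
by rewrite linearP opprD scalerBr addrACA.
Qed.

Lemma shift_bracket_comp b b' : operator b ->
  shift_bracket (b \o b') =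
  (shift_bracket b \o b') + (b \o shift_bracket b').
Proof.
move=> opb; apply/funext => g.
rewrite -[RHS]/(shift (b (b' g)) - b (shift (b' g)) +
  b (shift (b' g) - b' (shift g))).
rewrite [shift (b' g) - _]addrC -[- b' _]scaleN1r operator_linear // scaleN1r.
by rewrite [- _ + b _]addrC addrA subrK.
Qed.

Lemma shift_bracket_letter a n :
  shift_bracket (letter (a, n)) = letter (a, n.+1).
Proof. by apply/funext => g; apply: shift_letter. Qed.

Lemma shift_bracket_operator b : operator b -> operator (shift_bracket b).
Proof.
elim=> [|k b1 b2 _ opb1 _ opb2|[a n]|b1 b2 opb1 opDb1 opb2 opDb2].
- suff -> : shift_bracket 0 = 0 by exact: operator_zero.
  by apply/funext => g; rewrite /shift_bracket subr0 linear0.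
- by rewrite shift_bracket_linear; apply: operator_combination.
- by rewrite shift_bracket_letter; apply: operator_letter.
- rewrite shift_bracket_comp // -[_ + _]scale1r scalerDr.
  rewrite [1 *: (b1 \o _)]scale1r.
  by apply: operator_combination; apply: operator_comp.
Qed.

Lemma operator_pair_closed :
  operator (0 : (N -> N) * N).1 /\
  forall c (x y : (N -> N) * N), operator x.1 -> operator y.1 ->
    operator (c *: x + y).1.
Proof.
by split=> [|c x y]; [exact: operator_zero | exact: operator_combination].
Qed.

(** The carrier of the envelope: an operator stands for the element acting from
    the left and a function for the same element as a right factor. *)
Definition operator_pairs : subspace ((N -> N) * N)%type :=
  @Subspace K ((N -> N) * N)%type (fun x => operator x.1) operator_pair_closed.
Local Notation E := (subspace_type operator_pairs).

Definition act (x : E) : N -> N := (subspace_val x).1.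
Definition tail (x : E) : N := (subspace_val x).2.

Definition envelope_mul (x y : E) : E :=
  subspace_elt (x := (act x \o act y, act x (tail y)))
    (operator_comp (subspace_valP x) (subspace_valP y) : operator_pairs (_, _)).

Definition envelope_deriv (x : E) : E :=
  subspace_elt (x := (shift_bracket (act x), shift (tail x)))
    (shift_bracket_operator (subspace_valP x) : operator_pairs (_, _)).

Lemma envelope_ext (x y : E) : act x = act y -> tail x = tail y -> x = y.
Proof.
move=> eq_op eq_tail; apply: val_inj.
case: x y eq_op eq_tail => [[b g] op] [[b' g'] op'].
by rewrite /act /tail /= => -> ->.
Qed.

Lemma act_operator x : operator (act x).
Proof. exact: (subspace_valP x). Qed.

Lemma act_linear c x y : act (c *: x + y) = c *: act x + act y.
Proof. by []. Qed.

Lemma tail_linear c x y : tail (c *: x + y) = c *: tail x + tail y.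
Proof. by []. Qed.

Lemma act_mul x y : act (envelope_mul x y) = act x \o act y.
Proof. by []. Qed.

Lemma tail_mul x y : tail (envelope_mul x y) = act x (tail y).
Proof. by []. Qed.

Lemma act_deriv x : act (envelope_deriv x) = shift_bracket (act x).
Proof. by []. Qed.

Lemma tail_deriv x : tail (envelope_deriv x) = shift (tail x).
Proof. by []. Qed.

Lemma envelope_mul_bilinear : bilinear_for *:%R *:%R envelope_mul.
Proof.
split=> [y|x] c a b; apply: envelope_ext.
- by rewrite act_linear !act_mul act_linear.
- by rewrite tail_linear !tail_mul act_linear.
- rewrite act_linear !act_mul act_linear; apply/funext => g.
  exact: (operator_linear (act_operator x)).
- rewrite tail_linear !tail_mul tail_linear.
  exact: (operator_linear (act_operator x)).
Qed.

HB.instance Definition _ :=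
  bilinear_isBilinear.Build K E E E *:%R *:%R envelope_mul
    envelope_mul_bilinear.

Lemma envelope_deriv_linear : linear envelope_deriv.
Proof.
move=> c a b; apply: envelope_ext.
  by rewrite act_linear !act_deriv act_linear shift_bracket_linear.
by rewrite tail_linear !tail_deriv tail_linear shift_linear.
Qed.

HB.instance Definition _ :=
  GRing.isLinear.Build K E E *:%R envelope_deriv envelope_deriv_linear.

Definition envelope : algebra K := @Algebra K E envelope_mul.

Definition envelope_der : {linear envelope -> envelope} := envelope_deriv.

(** Both laws reduce to operators: associativity is immediate from composition,
    and left factors commute because operators do. *)
Lemma envelope_perm : perm_algebra envelope.
Proof.
split=> [x y z|x y z] /=; apply: envelope_ext; rewrite !(act_mul, tail_mul) //.
  apply/funext => g.
  exact: (operator_comm (act_operator x) (act_operator y)).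
exact: (operator_comm (act_operator x) (act_operator y)).
Qed.

Lemma envelope_derivation : derivation envelope_der.
Proof.
(* The factor 1 gives the sum the form to which the linearity rules apply. *)
move=> x y; rewrite -[X in X + _]scale1r; apply: envelope_ext.
  rewrite act_linear /= !(act_deriv, act_mul) scale1r.
  exact: (shift_bracket_comp _ (act_operator x)).
rewrite tail_linear /= !(tail_deriv, tail_mul) act_deriv scale1r.
by rewrite /shift_bracket subrK.
Qed.

Hypothesis laws : word_laws V.

Lemma word_action_compatible (y : V) :
  compatible (fun w : word => word_action w y).
Proof.
split=> [w1 w2 l l'|c a b n w|a b n w].
- exact: word_action_swap.
- exact: word_action_linear.
- exact: word_action_leibniz.
Qed.

Definition tail_function (y : V) : N :=
  subspace_elt (word_action_compatible y : compatible_functions _).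

Definition envelope_inj (a : V) : E :=
  subspace_elt (x := (letter (a, 0%N), tail_function a))
    (operator_letter (a, 0%N) : operator_pairs (_, _)).

Lemma act_inj a : act (envelope_inj a) = letter (a, 0%N).
Proof. by []. Qed.

Lemma tail_inj a : tail (envelope_inj a) = tail_function a.
Proof. by []. Qed.

Lemma envelope_inj_linear : linear envelope_inj.
Proof.
move=> c a b; apply: envelope_ext.
  rewrite act_linear !act_inj; apply/funext => g.
  exact: letter_vector_linear.
rewrite tail_linear !tail_inj; apply: compatible_function_ext => w.
exact: word_action_tail_linear.
Qed.

HB.instance Definition _ :=
  GRing.isLinear.Build K V E *:%R envelope_inj envelope_inj_linear.

(** In the first component this is the Leibniz law of words, with no derivative
    applied to [a *> b], and in the second the law for a tail [a *> b]. *)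
Lemma envelope_inj_succ a b :
  envelope_inj (a *> b) =
  envelope_mul (envelope_deriv (envelope_inj a)) (envelope_inj b).
Proof.
apply: envelope_ext.
  rewrite act_mul act_deriv !act_inj shift_bracket_letter.
  by apply/funext => g; apply: letter_succ.
rewrite tail_mul act_deriv act_inj !tail_inj shift_bracket_letter.
by apply: compatible_function_ext => w; apply: word_action_tail.
Qed.

(** Injectivity is read off at the empty word, whose action is the identity. *)
Lemma word_laws_DerPerm : DerPerm_succ V.
Proof.
exists envelope, envelope_der; split.
- exact: envelope_perm.
- exact: envelope_derivation.
- exists (envelope_inj : {linear V -> succ_algebra envelope_der}).
  split=> [a b /(congr1 tail)|]; last exact: envelope_inj_succ.
  by rewrite !tail_inj => /(congr1 (fun g : N => subspace_val g [::])).
Qed.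

End Envelope.

(** * The variety *)

Lemma DerPerm_succ_identities (K : fieldType) (V : algebra K) p :
  DerPerm_succ V -> succ_identity p -> satisfies V p.
Proof.
move=> [A [d [permA derd [f [f_inj fM]]]]] idp v; apply: f_inj.
have evf m : f (magma_eval v m) = magma_eval (f \o v) m.
  by elim: m => //= m1 IH1 m2 IH2; rewrite fM IH1 IH2.
rewrite linear0 -[RHS](idp A d permA derd (f \o v)) linear_sum.
by apply: eq_bigr => m _; rewrite linearZ evf.
Qed.

Theorem corollary2 (K : fieldType) : is_variety (@DerPerm_succ K).
Proof.
exists (@succ_identity K) => V; split=> [DV p|satV].
  exact: DerPerm_succ_identities.
exact/word_laws_DerPerm/identities_word_laws.
Qed.
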